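(* Let $m$ be a non-negative integer and let $r_0=\lfloor\frac{m}{3}\rfloor+1$. If $m\notin\{0,1,3,6,9,12\}$, then $f_m(0)<f_m(1)<\cdots<f_m(r_0)$.
   Context: For integers $m\ge 0$ and $r\ge 0$, $f_m(r)=2^{-r}\sum_{i=0}^r\binom{m}{i}$. *)

(* Defs.v *)
From mathcomp Require Import all_boot all_order all_algebra.

Set Implicit Arguments.
Unset Strict Implicit.
Unset Printing Implicit Defensive.

Import Order.TTheory GRing.Theory Num.Theory.
Local Open Scope ring_scope.

Definition f (m r : nat) : rat :=
  2%:R ^- r * \sum_(0 <= i < r.+1) ('C(m, i))%:R.

(* Main.v *)
Require Import Defs.
From mathcomp Require Import all_boot all_order all_algebra.
From mathcomp Require Import zify.

(** Write [S r] for the sum of the binomials ['C(m, i)], [i <= r]. The claim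
    [f m r < f m r.+1] says [S r < 'C(m, r.+1)]. The ratios
    [g r = S r / 'C(m, r.+1)] satisfy
    [g r = (r + 1) / (m - r) * (1 + g (r - 1))], and for [3 r <= m] induction on
    [r] gives [g r <= (r + 1) / (d + 2 r / (d + 7))] with [d = m - 2 r]. This
    bound is below 1 except for [m = 1] and for [m = 3 r] with [r <= 7]; among
    the latter, only [m = 15, 18, 21] have to be checked by computation. *)

Set Implicit Arguments.
Unset Strict Implicit.
Unset Printing Implicit Defensive.

Import Order.TTheory GRing.Theory Num.Theory.
Local Open Scope ring_scope.

Lemma f_ltS (m r : nat) :
  (f m r < f m r.+1) = (\sum_(0 <= i < r.+1) 'C(m, i) < 'C(m, r.+1))%N.
Proof.
rewrite /f [X in _ < _ * X]big_nat_recr //= -natr_sum.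
set S := (\sum_(0 <= i < r.+1) _)%N.
rewrite exprSr invfM -mulrA ltr_pM2l ?invr_gt0 ?exprn_gt0 //.
by rewrite ltr_pdivlMl // mulr_natl mulr2n ltrD2l ltr_nat.
Qed.

(* The shift 7 is the least one for which the induction step, whose slack is
   [8 (d - r) + 72], goes through for all [r <= d]. *)
Lemma sum_bin_le (r d : nat) : (r <= d)%N ->
  ((\sum_(0 <= i < r.+1) 'C(r.*2 + d, i)) * (d * (d + 7) + r.*2)
     <= (r + d) * (d + 7) * 'C(r.*2 + d, r))%N.
Proof.
elim: r d => [|r IHr] d le_rd; first by rewrite big_nat1 !bin0; lia.
rewrite big_nat_recr //=.
(* The row [r.*2 + d] stays fixed, so lowering [r] by one raises [d] by two. *)
have := IHr d.+2 (leq_trans (ltnW le_rd) (leq_addl 2 d)).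
have -> : (r.*2 + d.+2 = r.+1.*2 + d)%N by lia.
have := mul_bin_left (r.+1.*2 + d) r.
have -> : (r.+1.*2 + d - r = r + d.+2)%N by lia.
move: (\sum_(0 <= i < _) _)%N 'C(_, r) 'C(_, r.+1) => S c0 c1 c1E IH.
set q := (d * (d + 7) + r.+1.*2)%N.
set q' := (d.+2 * (d.+2 + 7) + r.*2)%N in IH.
have q'_gt0 : (0 < q')%N by rewrite /q'; lia.
have {c1E} IH' : (S * q' <= r.+1 * (d + 9) * c1)%N.
  by rewrite mulnAC c1E; lia.
have step : ((d + 9) * q <= q' * (d + 5))%N by rewrite /q /q'; lia.
(* [q] absorbs the new term [c1]; the rest, [S * q <= r.+1 * (d + 5) * c1], is proved after
   multiplying by [q']. *)
have split : ((r.+1 + d) * (d + 7) = q + r.+1 * (d + 5))%N by rewrite /q; lia.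
rewrite split -(leq_pmul2l q'_gt0).
have h1 := leq_mul IH' (leqnn q).
have h2 := leq_mul (leqnn (r.+1 * c1)%N) step.
clearbody q q'; clear -h1 h2; lia.
Qed.

Lemma sum_bin_lt (r d : nat) : (r <= d)%N ->
  ((r.+1 * (d + 7)) < d * (d + 7) + r.*2)%N ->
  (\sum_(0 <= i < r.+1) 'C(r.*2 + d, i) < 'C(r.*2 + d, r.+1))%N.
Proof.
move=> le_rd lt_q; have := sum_bin_le le_rd.
have := mul_bin_left (r.*2 + d) r.
have -> : (r.*2 + d - r = r + d)%N by lia.
have : (0 < 'C(r.*2 + d, r))%N by rewrite bin_gt0; lia.
have : (0 < \sum_(0 <= i < r.+1) 'C(r.*2 + d, i))%N.
  by rewrite big_nat_recl // bin0.
move: (\sum_(0 <= i < _) _)%N 'C(_, r) 'C(_, r.+1) => S c0 c1 S_gt0 c0_gt0 c1E.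
set q := (d * (d + 7) + r.*2)%N in lt_q *.
rewrite mulnAC -c1E mulnAC => le_Sq.
have lt_Sq : (S * (r.+1 * (d + 7)) < S * q)%N by rewrite ltn_pmul2l.
have := leq_trans lt_Sq le_Sq.
by rewrite [(S * _)%N]mulnC ltn_pmul2l //; lia.
Qed.

Theorem theorem6 (m : nat) (hm : m \notin [:: 0; 1; 3; 6; 9; 12]%N) :
  let r0 := (m %/ 3 + 1)%N in
  forall r : nat, (r < r0)%N -> f m r < f m r.+1.
Proof.
move=> r0 r lt_r; rewrite f_ltS.
have le_rm : (3 * r <= m)%N by rewrite /r0 in lt_r; lia.
have [d mE le_rd] : exists2 d, m = (r.*2 + d)%N & (r <= d)%N.
  by exists (m - r.*2)%N; lia.
rewrite !inE in hm; rewrite {}mE in hm *.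
have [lt_q|le_q] := ltnP (r.+1 * (d + 7)) (d * (d + 7) + r.*2).
  exact: sum_bin_lt.
(* If [r < d], then [le_q] forces [r = 0] and [d = 1], the excluded row 1. *)
have dE : d = r.
  apply/eqP; rewrite eqn_leq le_rd andbT leqNgt; apply/negP => lt_rd.
  have := leq_mul lt_rd (leqnn (d + 7)).
  have [r_gt0|] := ltnP 0 r; first by lia.
  rewrite leqn0 => /eqP r_eq0; subst r.
  have d_gt1 : (1 < d)%N by lia.
  by have := leq_mul d_gt1 (leqnn (d + 7)); lia.
(* With [d = r], [le_q] reads [r^2 + 9 r <= r^2 + 8 r + 7]; [hm] then rules out [r <= 4]. *)
subst d; have le_r7 : (r <= 7)%N by lia.
have : r \in [:: 5; 6; 7]%N by rewrite !inE; lia.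
by rewrite !inE => /or3P[] /eqP->; rewrite unlock; vm_compute.
Qed.
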